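(* Let $\mathsf{Bimod}$ be the category of cyclic pointed residuated bimodules, $\mathsf{NPos}$ the category of Nagata posemigroups and $\mathsf{NPos}_r$ the category of restricted Nagata posemigroups (all defined in the context). The Nagata product functor $\mathsf{Bimod}\to\mathsf{NPos}$ (respectively, the restricted Nagata product functor $\mathsf{Bimod}\to\mathsf{NPos}_r$) is right adjoint to the structural bimodule functor $\mathsf{NPos}\to\mathsf{Bimod}$ (respectively $\mathsf{NPos}_r\to\mathsf{Bimod}$). The unit of the adjunction at a (restricted) Nagata posemigroup $\mathbf N$ is the embedding $m\mapsto\langle\sigma m,\gamma m\rangle$ of $\mathbf N$ into the (restricted) Nagata product of its structural bimodule, and the counit at a bimodule is the inverse of the isomorphism $\langle e_S,e_M\rangle$ from the bimodule onto the structural bimodule of its (restricted) Nagata product.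
   Context: A posemigroup is $\langle S,\le,\cdot\rangle$ with $\langle S,\le\rangle$ a poset and $\langle S,\cdot\rangle$ a semigroup with multiplication isotone in both arguments. Bimodules: let $\mathbf S$ be a posemigroup and $\mathbf M=\langle M,\vee\rangle$ a join semilattice (order $\le$); elements of $S$ are written $a,b,c$ and elements of $M$ are written $x,y,z$. A residuated bimodule consists of $\mathbf S$, $\mathbf M$, isotone maps $S\times M\to M$, $(a,x)\mapsto a*x$ and $M\times S\to M$, $(x,a)\mapsto x*a$ satisfying $(a\cdot b)*x=a*(b*x)$, $x*(a\cdot b)=(x*a)*b$, $(a*x)*b=a*(x*b)$, $a*(x\vee y)=a*x\vee a*y$, $(x\vee y)*a=x*a\vee y*a$, together with maps $\backslash_\ell:S\times M\to M$, $/_\ell:M\times M\to S$, $\backslash_r:M\times M\to S$, $/_r:M\times S\to M$ such that $x\le a\backslash_\ell y\iff a*x\le y\iff a\le y/_\ell x$ and $x\le y/_r a\iff x*a\le y\iff a\le x\backslash_r y$. It is cyclic pointed if it has a constant $0\in M$ with $a*0=0*a$ for all $a\in S$. Morphisms in $\mathsf{Bimod}$ are pairs $(f,g)$ with $f:S\to S'$ an isotone semigroup homomorphism and $g:M\to M'$ a join-semilattice homomorphism preserving both actions, the four residuals and $0$. Nagata product: $\mathbf S\ltimes\mathbf M$ has universe $S\times M$ with componentwise order and multiplication $\langle a,x\rangle\circ\langle b,y\rangle=\langle a\cdot b,\ x*b\vee a*y\rangle$. The restricted Nagata product $(\mathbf S\ltimes\mathbf M)_0$ is the subposemigroup on $\{\langle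 a,x\rangle: 0*a\le x,\ a*0\le x\}$. On either, define $\sigma\langle a,x\rangle=\langle a,a*0\rangle$, $\gamma\langle a,x\rangle=\langle 0\backslash_r x,x\rangle$ ($=\langle x/_\ell 0,x\rangle$), $e_S(a)=\langle a,a*0\rangle$, $e_M(x)=\langle 0\backslash_r x,x\rangle$. It is viewed as a Nagata posemigroup with these $\sigma,\gamma$, constant $e_M(0)$, operations $m\backslash_\gamma n=m\backslash\gamma n$, $n/_\gamma m=\gamma n/m$ (these residuals exist) and $m\sqcup n=$ join of $\gamma m,\gamma n$ in the image of $\gamma$. On morphisms, $(f,g)$ is sent to $\langle a,x\rangle\mapsto\langle fa,gx\rangle$. Nagata posemigroups: for an idempotent isotone map $\gamma$ on a posemigroup $\mathbf N$, write $N_\gamma=\gamma[N]$. A pre-conucleus is an idempotent isotone $\sigma$ with $N_\sigma=\sigma[N]$ a subsemigroup. A $\sigma$-closure operator is an idempotent isotone $\gamma$ with $a\cdot x\le\gamma(a\cdot x)$ and $x\cdot a\le\gamma(x\cdot a)$ for $a\in N_\sigma$, $x\in N_\gamma$; it is $\sigma$-structural if $a\cdot\gamma m\le\gamma(a\cdot m)$ and $\gamma m\cdot a\le\gamma(m\cdot a)$ for $a\in N_\sigma$, $m\in N$. $\mathbf N$ is $\gamma$-residuated if the residuals $m\backslash x$ and $x/m$ exist for $m\in N$, $x\in N_\gamma$; it is then expanded by $m\backslash_\gamma n:=m\backslash\gamma n$ and $n/_\gamma m:=\gamma n/m$. $\mathbf N$ is a $\gamma$-join semilattice if any two elements of $N_\gamma$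 have a join in $N_\gamma$; it is then expanded by $m\sqcup n:=$ the join of $\gamma m,\gamma n$ in $N_\gamma$. A Nagata posemigroup is a posemigroup $\mathbf N$ with a pre-conucleus $\sigma$, a $\sigma$-structural $\sigma$-closure operator $\gamma$, and a constant $0\in N_\gamma$, which is a $\gamma$-residuated $\gamma$-join semilattice satisfying: $\sigma(x\cdot y)=\sigma x\cdot\sigma y$; $\gamma(x\cdot y)=\gamma(\gamma x\cdot\sigma y)\sqcup\gamma(\sigma x\cdot\gamma y)$; $\sigma(x\backslash_\gamma\gamma y)=\sigma(\gamma x\backslash_\gamma\gamma y)$; $\gamma(x\backslash_\gamma\gamma y)=\sigma x\backslash_\gamma\gamma y$; $\sigma(\gamma y/_\gamma x)=\sigma(\gamma y/_\gamma\gamma x)$; $\gamma(\gamma y/_\gamma x)=\gamma y/_\gamma\sigma x$; $\sigma\gamma x=\sigma(0\backslash_\gamma\gamma x)=\sigma(\gamma x/_\gamma 0)$; $\gamma\sigma x=\gamma(0\cdot\sigma x)=\gamma(\sigma x\cdot 0)$; and the quasi-inequality $\sigma x\le\sigma y$ and $\gamma x\le\gamma y$ imply $x\le y$. It is restricted if moreover $\sigma$ is an interior operator ($\sigma m\le m$) and $\gamma$ is a closure operator ($m\le\gamma m$). Morphisms of (restricted) Nagata posemigroups are isotone maps preserving $\cdot,\sigma,\gamma,0,\backslash_\gamma,/_\gamma,\sqcup$. Structural bimodule functor: sends $\mathbf N$ to the cyclic pointed residuated bimodule with scalars $N_\sigma$ (inherited order and multiplication), module $N_\gamma$ (inherited order,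 join $\sqcup$), actions $a*x=\gamma(a\cdot x)$, $x*a=\gamma(x\cdot a)$, residuals $x\backslash_r y=\sigma(x\backslash_\gamma y)$, $a\backslash_\ell x=\gamma(a\backslash_\gamma x)$, $y/_\ell x=\sigma(y/_\gamma x)$, $x/_r a=\gamma(x/_\gamma a)$, and point $0$; a morphism $h$ is sent to its restrictions to $N_\sigma$ and $N_\gamma$.
   Formalization: Unrestricted Nagata products can violate σ(x\γ γy)=σ(γx\γ γy) and its mirror image, so in the unrestricted case NPos is replaced by a larger category where γx in these two axioms becomes x⊔σx; every Nagata posemigroup is shown to belong to it. *)

(* Defs.v *)
(* Orders are Prop-valued relations on arbitrary types.  Operations whose
   existence is asserted by a universal property (residuals, joins) are fields
   of the structure, determined uniquely by that property. *)
From Stdlib Require Import Relation_Definitions Setoid.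
From Stdlib Require Import ProofIrrelevance FunctionalExtensionality.
From Stdlib Require Import ssreflect ssrfun.

Set Implicit Arguments.
Unset Strict Implicit.
Unset Printing Implicit Defensive.

Declare Scope nagata_scope.
Delimit Scope nagata_scope with nag.
Local Open Scope nagata_scope.

Reserved Notation "a *> x" (at level 40, left associativity).
Reserved Notation "x <* a" (at level 40, left associativity).
Reserved Notation "a \_l y" (at level 45, no associativity).
Reserved Notation "y /_l x" (at level 45, no associativity).
Reserved Notation "x \_r y" (at level 45, no associativity).
Reserved Notation "y /_r a" (at level 45, no associativity).
Reserved Notation "m \_g n" (at level 45, no associativity).
Reserved Notation "n /_g m" (at level 45, no associativity).
Reserved Notation "x \/_ y" (at level 50, left associativity).
Reserved Notation "m \_/ n" (at level 50, left associativity).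

Record category := Category {
  Ob :> Type;
  Hom : Ob -> Ob -> Type;
  idm : forall A, Hom A A;
  mcomp : forall A B C, Hom B C -> Hom A B -> Hom A C;
  mcomp_idl : forall A B (f : Hom A B), mcomp (idm B) f = f;
  mcomp_idr : forall A B (f : Hom A B), mcomp f (idm A) = f;
  mcompA : forall A B C D (h : Hom C D) (g : Hom B C) (f : Hom A B),
    mcomp h (mcomp g f) = mcomp (mcomp h g) f }.

Arguments idm {c} A.

Record functor (C D : category) := Functor {
  fob :> C -> D;
  fmap : forall A B : C, Hom A B -> Hom (fob A) (fob B);
  fmap_id : forall A, fmap (idm A) = idm (fob A);
  fmap_comp : forall A B E (g : Hom B E) (f : Hom A B),
    fmap (mcomp g f) = mcomp (fmap g) (fmap f) }.

Arguments fmap {C D} F {A B} f : rename.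

(* [adjunction F G] : F is left adjoint to G, in unit-counit form. *)
Record adjunction (C D : category) (F : functor C D) (G : functor D C) :=
  Adjunction {
    adj_unit : forall A : C, Hom A (G (F A));
    adj_counit : forall B : D, Hom (F (G B)) B;
    unit_natural : forall (A A' : C) (f : Hom A A'),
      mcomp (fmap G (fmap F f)) (adj_unit A) = mcomp (adj_unit A') f;
    counit_natural : forall (B B' : D) (g : Hom B B'),
      mcomp g (adj_counit B) = mcomp (adj_counit B') (fmap F (fmap G g));
    triangle_left : forall A : C,
      mcomp (adj_counit (F A)) (fmap F (adj_unit A)) = idm (F A);
    triangle_right : forall B : D,
      mcomp (fmap G (adj_counit B)) (adj_unit (G B)) = idm (G B) }.

Definition full_subcategory (C : category) (P : C -> Prop) : category :=
  @Category {A : C | P A}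
    (fun A B => Hom (proj1_sig A) (proj1_sig B))
    (fun A => idm (proj1_sig A))
    (fun A B D g f => mcomp g f)
    (fun A B f => mcomp_idl f)
    (fun A B f => mcomp_idr f)
    (fun A B D E h g f => mcompA h g f).

Record poset := Poset {
  po_car :> Type;
  po_le : relation po_car;
  po_order : order po_car po_le }.

Notation "x <= y" := (po_le x y) : nagata_scope.

Record posemigroup := Posemigroup {
  ps_poset :> poset;
  mul : ps_poset -> ps_poset -> ps_poset;
  mul_assoc : forall a b c, mul a (mul b c) = mul (mul a b) c;
  mul_isotone : forall a a' b b', a <= a' -> b <= b' -> mul a b <= mul a' b' }.

Notation "a * b" := (mul a b) : nagata_scope.

Record join_semilattice := JoinSemilattice {
  js_poset :> poset;
  join : js_poset -> js_poset -> js_poset;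
  join_lub : forall x y z, join x y <= z <-> x <= z /\ y <= z }.

Notation "x \/_ y" := (join x y) : nagata_scope.

Record bimodule := Bimodule {
  scal : posemigroup;
  modl : join_semilattice;
  lact : scal -> modl -> modl where "a *> x" := (lact a x);
  ract : modl -> scal -> modl where "x <* a" := (ract x a);
  ldl : scal -> modl -> modl where "a \_l y" := (ldl a y);
  rdl : modl -> modl -> scal where "y /_l x" := (rdl y x);
  ldr : modl -> modl -> scal where "x \_r y" := (ldr x y);
  rdr : modl -> scal -> modl where "y /_r a" := (rdr y a);
  bpt : modl;
  lact_isotone : forall a b x y, a <= b -> x <= y -> a *> x <= b *> y;
  ract_isotone : forall a b x y, a <= b -> x <= y -> x <* a <= y <* b;
  lactA : forall a b x, (a * b) *> x = a *> (b *> x);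
  ractA : forall a b x, x <* (a * b) = (x <* a) <* b;
  lractA : forall a b x, (a *> x) <* b = a *> (x <* b);
  lact_join : forall a x y, a *> (x \/_ y) = (a *> x) \/_ (a *> y);
  ract_join : forall a x y, (x \/_ y) <* a = (x <* a) \/_ (y <* a);
  ldlP : forall a x y, x <= a \_l y <-> a *> x <= y;
  rdlP : forall a x y, a <= y /_l x <-> a *> x <= y;
  rdrP : forall a x y, x <= y /_r a <-> x <* a <= y;
  ldrP : forall a x y, a <= x \_r y <-> x <* a <= y;
  cyclic : forall a, a *> bpt = bpt <* a }.

Notation "a *> x" := (lact a x) : nagata_scope.
Notation "x <* a" := (ract x a) : nagata_scope.
Notation "a \_l y" := (ldl a y) : nagata_scope.
Notation "y /_l x" := (rdl y x) : nagata_scope.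
Notation "x \_r y" := (ldr x y) : nagata_scope.
Notation "y /_r a" := (rdr y a) : nagata_scope.

Record bimodule_hom (B B' : bimodule) := BimoduleHom {
  hscal : scal B -> scal B';
  hmodl : modl B -> modl B';
  hscal_isotone : forall a b, a <= b -> hscal a <= hscal b;
  hscal_mul : forall a b, hscal (a * b) = hscal a * hscal b;
  hmodl_join : forall x y, hmodl (x \/_ y) = hmodl x \/_ hmodl y;
  h_lact : forall a x, hmodl (a *> x) = hscal a *> hmodl x;
  h_ract : forall a x, hmodl (x <* a) = hmodl x <* hscal a;
  h_ldl : forall a y, hmodl (a \_l y) = hscal a \_l hmodl y;
  h_rdl : forall x y, hscal (y /_l x) = hmodl y /_l hmodl x;
  h_ldr : forall x y, hscal (x \_r y) = hmodl x \_r hmodl y;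
  h_rdr : forall a y, hmodl (y /_r a) = hmodl y /_r hscal a;
  h_bpt : hmodl (bpt B) = bpt B' }.

Lemma bimodule_hom_ext (B B' : bimodule) (f g : bimodule_hom B B') :
  (forall a, hscal f a = hscal g a) -> (forall x, hmodl f x = hmodl g x) ->
  f = g.
Proof.
case: f g => [f1 f2 ? ? ? ? ? ? ? ? ? ?] [g1 g2 ? ? ? ? ? ? ? ? ? ?] /= E1 E2.
have H1 : f1 = g1 by apply: functional_extensionality.
have H2 : f2 = g2 by apply: functional_extensionality.
by subst g1 g2; f_equal; apply: proof_irrelevance.
Qed.

Definition bimodule_id (B : bimodule) : bimodule_hom B B.
Proof. by exists id id. Defined.

Definition bimodule_comp (A B C : bimodule)
  (g : bimodule_hom B C) (f : bimodule_hom A B) : bimodule_hom A C.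
Proof.
exists (fun a => hscal g (hscal f a)) (fun x => hmodl g (hmodl f x)).
- by move=> a b ab; do 2 apply: hscal_isotone.
- by move=> a b; rewrite !hscal_mul.
- by move=> x y; rewrite !hmodl_join.
- by move=> a x; rewrite !h_lact.
- by move=> a x; rewrite !h_ract.
- by move=> a x; rewrite !h_ldl.
- by move=> a x; rewrite !h_rdl.
- by move=> a x; rewrite !h_ldr.
- by move=> a x; rewrite !h_rdr.
- by rewrite !h_bpt.
Defined.

Definition Bimod : category.
Proof.
exists bimodule bimodule_hom bimodule_id bimodule_comp.
- by move=> A B f; apply: bimodule_hom_ext.
- by move=> A B f; apply: bimodule_hom_ext.
- by move=> A B C D h g f; apply: bimodule_hom_ext.
Defined.

Definition img (A : Type) (f : A -> A) : Type := {y : A | exists x, f x = y}.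

Definition to_img (A : Type) (f : A -> A) (x : A) : img f :=
  exist _ (f x) (ex_intro _ x eq_refl).

Record nagata_algebra := NagataAlgebra {
  na_ps :> posemigroup;
  sg : na_ps -> na_ps;
  gm : na_ps -> na_ps;
  npt : na_ps;
  ldg : na_ps -> na_ps -> na_ps;
  rdg : na_ps -> na_ps -> na_ps;
  sqcup : na_ps -> na_ps -> na_ps }.

Arguments sg {n} _.
Arguments gm {n} _.
Arguments npt {n}.

Notation "m \_g n" := (ldg m n) : nagata_scope.
Notation "n /_g m" := (rdg n m) : nagata_scope.
Notation "m \_/ n" := (sqcup m n) : nagata_scope.

Section NagataAxioms.

Variable N : posemigroup.
Implicit Types s g : N -> N.

Definition idempotent_isotone g :=
  (forall m, g (g m) = g m) /\ (forall m n, m <= n -> g m <= g n).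

Definition pre_conucleus s :=
  idempotent_isotone s /\
  (forall a b : img s, exists c, s c = proj1_sig a * proj1_sig b).

Definition closure_operator_over s g :=
  idempotent_isotone g /\
  (forall (a : img s) (x : img g),
     proj1_sig a * proj1_sig x <= g (proj1_sig a * proj1_sig x) /\
     proj1_sig x * proj1_sig a <= g (proj1_sig x * proj1_sig a)).

Definition structural_over s g :=
  forall (a : img s) (m : N),
    proj1_sig a * g m <= g (proj1_sig a * m) /\
    g m * proj1_sig a <= g (m * proj1_sig a).

Lemma pre_conucleusI s : idempotent_isotone s ->
  (forall a b, exists c, s c = s a * s b) -> pre_conucleus s.
Proof.
by move=> Hs H; split=> // -[_a [a Ea]] [_b [b Eb]] /=; subst _a _b; apply: H.
Qed.

Lemma closure_operator_overI s g : idempotent_isotone g ->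
  (forall a x, s a * g x <= g (s a * g x) /\ g x * s a <= g (g x * s a)) ->
  closure_operator_over s g.
Proof.
by move=> Hg H; split=> // -[_a [a Ea]] [_x [x Ex]] /=; subst _a _x; apply: H.
Qed.

Lemma structural_overI s g :
  (forall a m, s a * g m <= g (s a * m) /\ g m * s a <= g (m * s a)) ->
  structural_over s g.
Proof. by move=> H [_a [a Ea]] m /=; subst _a; apply: H. Qed.

End NagataAxioms.

(* All the axioms of Nagata posemigroups except
     sg (x \_g gm y) = sg (gm x \_g gm y)  and its mirror image. *)
Record nagata_core (N : nagata_algebra) : Prop := NagataCore {
  sg_pre_conucleus : pre_conucleus (@sg N);
  gm_closure : closure_operator_over (@sg N) (@gm N);
  gm_structural : structural_over (@sg N) (@gm N);
  npt_img : exists m : N, gm m = npt;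
  ldgP : forall m n k : N, k <= m \_g n <-> m * k <= gm n;
  rdgP : forall m n k : N, k <= n /_g m <-> k * m <= gm n;
  sqcup_img : forall m n : N, exists k : N, gm k = m \_/ n;
  sqcup_lub : forall (m n : N) (z : img (@gm N)),
    m \_/ n <= proj1_sig z <-> gm m <= proj1_sig z /\ gm n <= proj1_sig z;
  sg_mul : forall x y : N, sg (x * y) = sg x * sg y;
  gm_mul : forall x y : N, gm (x * y) = gm (gm x * sg y) \_/ gm (sg x * gm y);
  gm_ldg : forall x y : N, gm (x \_g gm y) = sg x \_g gm y;
  gm_rdg : forall x y : N, gm (gm y /_g x) = gm y /_g sg x;
  sg_gm : forall x : N,
    sg (gm x) = sg (npt \_g gm x) /\ sg (gm x) = sg (gm x /_g npt);
  gm_sg : forall x : N,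
    gm (sg x) = gm (npt * sg x) /\ gm (sg x) = gm (sg x * npt);
  nagata_quasi : forall x y : N, sg x <= sg y -> gm x <= gm y -> x <= y }.

Record nagata (N : nagata_algebra) : Prop := Nagata {
  nagata_is_core :> nagata_core N;
  sg_ldg : forall x y : N, sg (x \_g gm y) = sg (gm x \_g gm y);
  sg_rdg : forall x y : N, sg (gm y /_g x) = sg (gm y /_g gm x) }.

Record restricted_nagata (N : nagata_algebra) : Prop := RestrictedNagata {
  restricted_is_nagata :> nagata N;
  sg_interior : forall m : N, sg m <= m;
  gm_extensive : forall m : N, m <= gm m }.

(* Unrestricted Nagata products need not satisfy [sg_ldg] and [sg_rdg], see
   [nagata_product_not_nagata] below.  They do satisfy the following weaker
   form, in which gm x is replaced by x \_/ sg x, the join of gm x and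
   gm (sg x).  It follows from [nagata], and it is equivalent to [nagata]
   when sg m <= m, since gm (sg x) <= gm x then. *)
Record weak_nagata (N : nagata_algebra) : Prop := WeakNagata {
  weak_nagata_is_core :> nagata_core N;
  sg_ldg_weak : forall x y : N, sg (x \_g gm y) = sg ((x \_/ sg x) \_g gm y);
  sg_rdg_weak : forall x y : N, sg (gm y /_g x) = sg (gm y /_g (x \_/ sg x)) }.

Record nagata_hom (N N' : nagata_algebra) := NagataHom {
  nhom :> N -> N';
  nhom_isotone : forall m n, m <= n -> nhom m <= nhom n;
  nhom_mul : forall m n, nhom (m * n) = nhom m * nhom n;
  nhom_sg : forall m, nhom (sg m) = sg (nhom m);
  nhom_gm : forall m, nhom (gm m) = gm (nhom m);
  nhom_npt : nhom npt = npt;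
  nhom_ldg : forall m n, nhom (m \_g n) = nhom m \_g nhom n;
  nhom_rdg : forall m n, nhom (n /_g m) = nhom n /_g nhom m;
  nhom_sqcup : forall m n, nhom (m \_/ n) = nhom m \_/ nhom n }.

Lemma nagata_hom_ext (N N' : nagata_algebra) (f g : nagata_hom N N') :
  (forall m, f m = g m) -> f = g.
Proof.
case: f g => [f ? ? ? ? ? ? ? ?] [g ? ? ? ? ? ? ? ?] /= E.
have H : f = g by apply: functional_extensionality.
by subst g; f_equal; apply: proof_irrelevance.
Qed.

Definition nagata_id (N : nagata_algebra) : nagata_hom N N.
Proof. by exists id. Defined.

Definition nagata_comp (A B C : nagata_algebra)
  (g : nagata_hom B C) (f : nagata_hom A B) : nagata_hom A C.
Proof.
exists (fun m => g (f m)).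
- by move=> m n mn; do 2 apply: nhom_isotone.
- by move=> m n; rewrite !nhom_mul.
- by move=> m; rewrite !nhom_sg.
- by move=> m; rewrite !nhom_gm.
- by rewrite !nhom_npt.
- by move=> m n; rewrite !nhom_ldg.
- by move=> m n; rewrite !nhom_rdg.
- by move=> m n; rewrite !nhom_sqcup.
Defined.

Definition NAlg : category.
Proof.
exists nagata_algebra nagata_hom nagata_id nagata_comp.
- by move=> A B f; apply: nagata_hom_ext.
- by move=> A B f; apply: nagata_hom_ext.
- by move=> A B C D h g f; apply: nagata_hom_ext.
Defined.

Definition NPosr : category := @full_subcategory NAlg restricted_nagata.
Definition NPosw : category := @full_subcategory NAlg weak_nagata.

Lemma po_refl (P : poset) (x : P) : x <= x.
Proof. by case: (po_order P) => R T A; apply: R. Qed.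

Lemma po_trans (P : poset) (y x z : P) : x <= y -> y <= z -> x <= z.
Proof. by case: (po_order P) => R T A; apply: T. Qed.

Lemma po_anti (P : poset) (x y : P) : x <= y -> y <= x -> x = y.
Proof. by case: (po_order P) => R T A; apply: A. Qed.

Lemma po_eq_le (P : poset) (x y : P) : x = y -> x <= y.
Proof. by move=> ->; apply: po_refl. Qed.

Lemma po_ext (P : poset) (x y : P) : (forall z, z <= x <-> z <= y) -> x = y.
Proof.
by move=> H; apply: po_anti; [apply/H | apply/H]; apply: po_refl.
Qed.

Lemma po_ext_up (P : poset) (x y : P) : (forall z, x <= z <-> y <= z) -> x = y.
Proof.
by move=> H; apply: po_anti; [apply/H | apply/H]; apply: po_refl.
Qed.

Lemma mul_l (S : posemigroup) (a b c : S) : a <= b -> a * c <= b * c.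
Proof. by move=> H; apply: mul_isotone => //; apply: po_refl. Qed.

Lemma mul_r (S : posemigroup) (a b c : S) : a <= b -> c * a <= c * b.
Proof. by move=> H; apply: mul_isotone => //; apply: po_refl. Qed.

Lemma sub_eq (A : Type) (Q : A -> Prop) (x y : {z : A | Q z}) :
  proj1_sig x = proj1_sig y -> x = y.
Proof.
case: x y => [x p] [y q] /= E; subst y.
by rewrite (proof_irrelevance _ p q).
Qed.

Lemma img_fix (A : Type) (f : A -> A) :
  (forall m, f (f m) = f m) -> forall y : img f, f (proj1_sig y) = proj1_sig y.
Proof. by move=> ff [y [x E]] /=; rewrite -E. Qed.

Definition sub_poset (P : poset) (Q : P -> Prop) : poset.
Proof.
exists {x : P | Q x} (fun x y => proj1_sig x <= proj1_sig y); split.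
- by move=> x; apply: po_refl.
- by move=> x y z; apply: po_trans.
- by move=> x y H1 H2; apply: sub_eq; apply: po_anti.
Defined.

Definition sub_posemigroup (S : posemigroup) (Q : S -> Prop)
  (HQ : forall a b, Q a -> Q b -> Q (a * b)) : posemigroup.
Proof.
exists (sub_poset Q)
  (fun a b => exist _ (proj1_sig a * proj1_sig b)
                 (HQ _ _ (proj2_sig a) (proj2_sig b))).
- by move=> a b c; apply: sub_eq; apply: mul_assoc.
- by move=> a a' b b'; apply: mul_isotone.
Defined.

Section Structural.

Variables (N : nagata_algebra) (HN : nagata_core N).
Implicit Types a b k m n x y z : N.

Lemma core_sgK m : sg (sg m) = sg m.
Proof. by case: (sg_pre_conucleus HN) => [] []. Qed.

Lemma core_sg_iso m n : m <= n -> sg m <= sg n.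
Proof. by case: (sg_pre_conucleus HN) => [] [] _ H _; apply: H. Qed.

Lemma core_gmK m : gm (gm m) = gm m.
Proof. by case: (gm_closure HN) => [] []. Qed.

Lemma core_gm_iso m n : m <= n -> gm m <= gm n.
Proof. by case: (gm_closure HN) => [] [] _ H _; apply: H. Qed.

Lemma core_gm_le m x : gm x = x -> m <= x -> gm m <= x.
Proof. by move=> Ex H; rewrite -Ex; apply: core_gm_iso. Qed.

Lemma core_sg_closed a b :
  (exists c, sg c = a) -> (exists c, sg c = b) -> exists c, sg c = a * b.
Proof.
move=> Ha Hb.
by case: (sg_pre_conucleus HN) => _ /(_ (exist _ a Ha) (exist _ b Hb)).
Qed.

Lemma core_clos a x : sg a = a -> gm x = x ->
  a * x <= gm (a * x) /\ x * a <= gm (x * a).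
Proof.
move=> Ea Ex; case: (gm_closure HN) => _ /(_ (to_img sg a) (to_img gm x)) /=.
by rewrite Ea Ex.
Qed.

Lemma core_str a m : sg a = a ->
  a * gm m <= gm (a * m) /\ gm m * a <= gm (m * a).
Proof.
by move=> Ea; have := gm_structural HN (to_img sg a) m; rewrite /= Ea.
Qed.

Lemma core_gm_npt : gm npt = npt :> N.
Proof. by case: (npt_img HN) => m <-; apply: core_gmK. Qed.

Lemma core_gm_sqcup m n : gm (m \_/ n) = m \_/ n.
Proof. by case: (sqcup_img HN m n) => k <-; apply: core_gmK. Qed.

Lemma core_sqcupP m n z : gm z = z ->
  m \_/ n <= z <-> gm m <= z /\ gm n <= z.
Proof. by move=> Ez; have := sqcup_lub HN m n (to_img gm z); rewrite /= Ez. Qed.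

Lemma core_sqcup_l m n : gm m <= m \_/ n.
Proof.
by case/(core_sqcupP _ _ (core_gm_sqcup m n)): (po_refl (m \_/ n)).
Qed.

Lemma core_sqcup_r m n : gm n <= m \_/ n.
Proof.
by case/(core_sqcupP _ _ (core_gm_sqcup m n)): (po_refl (m \_/ n)).
Qed.

Lemma core_ldgP x y z : gm y = y -> z <= x \_g y <-> x * z <= y.
Proof. by move=> Ey; rewrite (ldgP HN) Ey. Qed.

Lemma core_rdgP x y z : gm y = y -> z <= y /_g x <-> z * x <= y.
Proof. by move=> Ey; rewrite (rdgP HN) Ey. Qed.

Lemma core_lactP a x y : sg a = a -> gm x = x -> gm y = y ->
  gm (a * x) <= y <-> a * x <= y.
Proof.
move=> Ea Ex Ey; split; last exact: core_gm_le.
by apply: po_trans; case: (core_clos Ea Ex).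
Qed.

Lemma core_ractP a x y : sg a = a -> gm x = x -> gm y = y ->
  gm (x * a) <= y <-> x * a <= y.
Proof.
move=> Ea Ex Ey; split; last exact: core_gm_le.
by apply: po_trans; case: (core_clos Ea Ex).
Qed.

Lemma core_gm_mul_l a m : sg a = a -> m <= gm m -> gm (a * gm m) = gm (a * m).
Proof.
move=> Ea mm; apply: po_anti; last by apply: core_gm_iso; apply: mul_r.
by apply: core_gm_le; [apply: core_gmK | case: (core_str m Ea)].
Qed.

Lemma core_gm_mul_r a m : sg a = a -> m <= gm m -> gm (gm m * a) = gm (m * a).
Proof.
move=> Ea mm; apply: po_anti; last by apply: core_gm_iso; apply: mul_l.
by apply: core_gm_le; [apply: core_gmK | case: (core_str m Ea)].
Qed.

Lemma core_ldlP a x y : sg a = a -> gm x = x -> gm y = y ->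
  x <= gm (a \_g y) <-> a * x <= y.
Proof.
move=> Ea Ex Ey; split=> H; last first.
  by rewrite -Ex; apply: core_gm_iso; apply/(core_ldgP _ _ Ey).
apply: (po_trans (y := a * gm (a \_g y))); first exact: mul_r.
apply: (po_trans (y := gm (a * (a \_g y)))); first by case: (core_str (a \_g y) Ea).
by apply: core_gm_le => //; apply/(core_ldgP _ _ Ey); apply: po_refl.
Qed.

Lemma core_rdrP a x y : sg a = a -> gm x = x -> gm y = y ->
  x <= gm (y /_g a) <-> x * a <= y.
Proof.
move=> Ea Ex Ey; split=> H; last first.
  by rewrite -Ex; apply: core_gm_iso; apply/(core_rdgP _ _ Ey).
apply: (po_trans (y := gm (y /_g a) * a)); first exact: mul_l.
apply: (po_trans (y := gm ((y /_g a) * a))); first by case: (core_str (y /_g a) Ea).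
by apply: core_gm_le => //; apply/(core_rdgP _ _ Ey); apply: po_refl.
Qed.

Lemma core_ldr_bound m y : gm y = y -> gm m * sg (m \_g y) <= y.
Proof.
move=> Ey; set k := m \_g y.
apply: (po_trans (y := gm (gm m * sg k))).
  by case: (core_clos (core_sgK k) (core_gmK m)).
apply: (po_trans (y := gm (m * k))); last first.
  by apply: core_gm_le => //; apply/(core_ldgP _ _ Ey); apply: po_refl.
by rewrite -core_gmK (gm_mul HN m k); apply: core_sqcup_l.
Qed.

Lemma core_rdl_bound m y : gm y = y -> sg (y /_g m) * gm m <= y.
Proof.
move=> Ey; set k := y /_g m.
apply: (po_trans (y := gm (sg k * gm m))).
  by case: (core_clos (core_sgK k) (core_gmK m)).
apply: (po_trans (y := gm (k * m))); last first.
  by apply: core_gm_le => //; apply/(core_rdgP _ _ Ey); apply: po_refl.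
by rewrite -core_gmK (gm_mul HN k m); apply: core_sqcup_r.
Qed.

Lemma core_ldrP a x y : sg a = a -> gm x = x -> gm y = y ->
  a <= sg (x \_g y) <-> x * a <= y.
Proof.
move=> Ea Ex Ey; split=> H; last first.
  by rewrite -Ea; apply: core_sg_iso; apply/(core_ldgP _ _ Ey).
apply: po_trans (core_ldr_bound x Ey); rewrite Ex; exact: mul_r.
Qed.

Lemma core_rdlP a x y : sg a = a -> gm x = x -> gm y = y ->
  a <= sg (y /_g x) <-> a * x <= y.
Proof.
move=> Ea Ex Ey; split=> H; last first.
  by rewrite -Ea; apply: core_sg_iso; apply/(core_rdgP _ _ Ey).
apply: po_trans (core_rdl_bound x Ey); rewrite Ex; exact: mul_l.
Qed.

Lemma sgE (a : img (@sg N)) : sg (proj1_sig a) = proj1_sig a.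
Proof. exact: (img_fix core_sgK). Qed.

Lemma gmE (x : img (@gm N)) : gm (proj1_sig x) = proj1_sig x.
Proof. exact: (img_fix core_gmK). Qed.

Definition str_scal : posemigroup := sub_posemigroup core_sg_closed.

Definition str_modl : join_semilattice.
Proof.
exists (sub_poset (fun x : N => exists m, gm m = x))
  (fun x y : img gm =>
     exist _ (proj1_sig x \_/ proj1_sig y) (sqcup_img HN _ _)).
by move=> x y z /=; rewrite core_sqcupP ?gmE.
Defined.

Definition structural_bimodule : bimodule.
Proof.
refine (@Bimodule str_scal str_modl
  (fun (a : img sg) (x : img gm) => to_img gm (proj1_sig a * proj1_sig x))
  (fun (x : img gm) (a : img sg) => to_img gm (proj1_sig x * proj1_sig a))
  (fun (a : img sg) (x : img gm) => to_img gm (proj1_sig a \_g proj1_sig x))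
  (fun (y x : img gm) => to_img sg (proj1_sig y /_g proj1_sig x))
  (fun (x y : img gm) => to_img sg (proj1_sig x \_g proj1_sig y))
  (fun (x : img gm) (a : img sg) => to_img gm (proj1_sig x /_g proj1_sig a))
  (exist _ npt (npt_img HN)) _ _ _ _ _ _ _ _ _ _ _ _).
- by move=> a b x y ab xy /=; apply: core_gm_iso; apply: mul_isotone.
- by move=> a b x y ab xy /=; apply: core_gm_iso; apply: mul_isotone.
- move=> a b x; apply: sub_eq => /=.
  rewrite core_gm_mul_l ?sgE ?mul_assoc //.
  by case: (core_clos (sgE b) (gmE x)).
- move=> a b x; apply: sub_eq => /=.
  rewrite core_gm_mul_r ?sgE ?mul_assoc //.
  by case: (core_clos (sgE a) (gmE x)).
- move=> a b x; apply: sub_eq => /=.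
  have [Hax _] := core_clos (sgE a) (gmE x).
  have [_ Hxb] := core_clos (sgE b) (gmE x).
  by rewrite (core_gm_mul_r (sgE b) Hax) (core_gm_mul_l (sgE a) Hxb) mul_assoc.
- move=> a x y; apply: (po_ext_up (P := str_modl)) => z.
  rewrite join_lub /= !core_lactP ?sgE ?gmE ?core_gm_sqcup //.
  rewrite -!core_ldlP ?sgE ?gmE ?core_gm_sqcup //.
  by rewrite core_sqcupP ?core_gmK // !gmE.
- move=> x y a; apply: (po_ext_up (P := str_modl)) => z.
  rewrite join_lub /= !core_ractP ?sgE ?gmE ?core_gm_sqcup //.
  rewrite -!core_rdrP ?sgE ?gmE ?core_gm_sqcup //.
  by rewrite core_sqcupP ?core_gmK // !gmE.
- by move=> a x y /=; rewrite core_ldlP ?core_lactP ?sgE ?gmE.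
- by move=> a x y /=; rewrite core_rdlP ?core_lactP ?sgE ?gmE.
- by move=> a x y /=; rewrite core_rdrP ?core_ractP ?sgE ?gmE.
- by move=> a x y /=; rewrite core_ldrP ?core_ractP ?sgE ?gmE.
- move=> a; apply: sub_eq => /=; rewrite -{1 2}(sgE a).
  by case: (gm_sg HN (proj1_sig a)) => <- <-.
Defined.

End Structural.

Lemma img_nhom_sg (N N' : nagata_algebra) (HN : nagata_core N)
  (h : nagata_hom N N') (a : img (@sg N)) : exists m, sg m = h (proj1_sig a).
Proof. by exists (h (proj1_sig a)); rewrite -nhom_sg sgE. Qed.

Lemma img_nhom_gm (N N' : nagata_algebra) (HN : nagata_core N)
  (h : nagata_hom N N') (x : img (@gm N)) : exists m, gm m = h (proj1_sig x).
Proof. by exists (h (proj1_sig x)); rewrite -nhom_gm gmE. Qed.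

Definition structural_map (N N' : nagata_algebra)
  (HN : nagata_core N) (HN' : nagata_core N') (h : nagata_hom N N') :
  bimodule_hom (structural_bimodule HN) (structural_bimodule HN').
Proof.
refine (@BimoduleHom (structural_bimodule HN) (structural_bimodule HN')
  (fun a : img sg => exist _ (h (proj1_sig a)) (img_nhom_sg HN h a))
  (fun x : img gm => exist _ (h (proj1_sig x)) (img_nhom_gm HN h x))
  _ _ _ _ _ _ _ _ _ _).
- by move=> a b; apply: nhom_isotone.
- by move=> a b; apply: sub_eq; apply: nhom_mul.
- by move=> x y; apply: sub_eq; apply: nhom_sqcup.
- by move=> a x; apply: sub_eq; rewrite /= nhom_gm nhom_mul.
- by move=> a x; apply: sub_eq; rewrite /= nhom_gm nhom_mul.
- by move=> a x; apply: sub_eq; rewrite /= nhom_gm nhom_ldg.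
- by move=> a x; apply: sub_eq; rewrite /= nhom_sg nhom_rdg.
- by move=> a x; apply: sub_eq; rewrite /= nhom_sg nhom_ldg.
- by move=> a x; apply: sub_eq; rewrite /= nhom_gm nhom_rdg.
- by apply: sub_eq; apply: nhom_npt.
Defined.

Definition structural_functor (P : NAlg -> Prop)
  (HP : forall N, P N -> nagata_core N) :
  functor (@full_subcategory NAlg P) Bimod.
Proof.
exists (fun N => structural_bimodule (HP _ (proj2_sig N)) : Bimod)
  (fun N N' h => structural_map (HP _ (proj2_sig N)) (HP _ (proj2_sig N')) h).
- by move=> N; apply: bimodule_hom_ext => a; apply: sub_eq.
- by move=> N1 N2 N3 g f; apply: bimodule_hom_ext => a; apply: sub_eq.
Defined.

Definition structuralr : functor NPosr Bimod :=
  structural_functor (fun N (H : restricted_nagata N) => H : nagata_core N).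
Definition structuralw : functor NPosw Bimod :=
  structural_functor (fun N (H : weak_nagata N) => H : nagata_core N).

Section Product.

Variable B : bimodule.
Local Notation S := (scal B).
Local Notation M := (modl B).
Local Notation "0" := (bpt B) : nagata_scope.
Implicit Types (a b c : S) (x y z : M).

Definition prod_poset : poset.
Proof.
exists (S * M)%type (fun m n => m.1 <= n.1 /\ m.2 <= n.2); split.
- by move=> m; split; apply: po_refl.
- by move=> m n k [? ?] [? ?]; split; apply: po_trans; eassumption.
- by move=> [a x] [b y] [/= ? ?] [? ?]; f_equal; apply: po_anti.
Defined.

Lemma join_l x y : x <= x \/_ y.
Proof. by case/join_lub: (po_refl (x \/_ y)). Qed.

Lemma join_r x y : y <= x \/_ y.
Proof. by case/join_lub: (po_refl (x \/_ y)). Qed.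

Lemma join_iso x x' y y' : x <= x' -> y <= y' -> x \/_ y <= x' \/_ y'.
Proof.
move=> H1 H2; apply/join_lub; split.
  by apply: po_trans H1 _; apply: join_l.
by apply: po_trans H2 _; apply: join_r.
Qed.

Lemma join_absorb x y : y <= x -> x \/_ y = x.
Proof.
move=> H; apply: po_ext_up => z; rewrite join_lub.
by split=> [[] //|xz]; split=> //; apply: po_trans xz.
Qed.

Lemma join_absorb_l x y : x <= y -> x \/_ y = y.
Proof.
move=> H; apply: po_ext_up => z; rewrite join_lub.
by split=> [[] //|yz]; split=> //; apply: po_trans yz.
Qed.

Lemma lact_r a x y : x <= y -> a *> x <= a *> y.
Proof. by move=> H; apply: lact_isotone => //; apply: po_refl. Qed.

Lemma lact_l a b x : a <= b -> a *> x <= b *> x.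
Proof. by move=> H; apply: lact_isotone => //; apply: po_refl. Qed.

Lemma ract_r a b x : a <= b -> x <* a <= x <* b.
Proof. by move=> H; apply: ract_isotone => //; apply: po_refl. Qed.

Lemma ract_l a x y : x <= y -> x <* a <= y <* a.
Proof. by move=> H; apply: ract_isotone => //; apply: po_refl. Qed.

Definition prod_ps : posemigroup.
Proof.
exists prod_poset
  (fun m n : S * M => (m.1 * n.1, (m.2 <* n.1) \/_ (m.1 *> n.2))).
- move=> [a x] [b y] [c z]; rewrite /= mul_assoc; f_equal.
  rewrite ractA lactA lact_join ract_join lractA.
  by apply: po_ext_up => w; rewrite !join_lub; split=> [[? []]|[[]]].
- move=> [a x] [a' x'] [b y] [b' y'] [/= ? ?] [? ?]; split.
    exact: mul_isotone.
  by apply: join_iso; [apply: ract_isotone | apply: lact_isotone].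
Defined.

Definition e_scal (a : S) : S * M := (a, a *> 0).
Definition e_modl (x : M) : S * M := (0 \_r x, x).

(* The formulas for m \_g n and n /_g m compute the residuals m \ gm n and
   gm n / m of the product order: see [ldgP_prod] and [rdgP_prod].  The first
   component involves a *> 0 because the product a * c must be below
   0 \_r y, that is (a *> 0) <* c <= y.  On the restricted product
   x \/_ (a *> 0) = x. *)
Definition nagata_product : nagata_algebra :=
  @NagataAlgebra prod_ps
    (fun m : S * M => e_scal m.1)
    (fun m : S * M => e_modl m.2)
    (e_modl 0)
    (fun m n : S * M => ((m.2 \/_ (m.1 *> 0)) \_r n.2, m.1 \_l n.2))
    (fun n m : S * M => (n.2 /_l (m.2 \/_ (m.1 *> 0)), n.2 /_r m.1))
    (fun m n : S * M => e_modl (m.2 \/_ n.2)).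

Lemma ldr_iso x y z : y <= z -> x \_r y <= x \_r z.
Proof.
by move=> H; apply/ldrP; apply: po_trans H; apply/ldrP; apply: po_refl.
Qed.

Lemma ldr_le x y : x <* (x \_r y) <= y.
Proof. by apply/ldrP; apply: po_refl. Qed.

Lemma e_modl_sym x : 0 \_r x = x /_l 0.
Proof. by apply: po_ext => a; rewrite ldrP rdlP cyclic. Qed.

Lemma e_modl_l x : (0 \_r x) *> 0 <= x.
Proof. by rewrite cyclic; apply: ldr_le. Qed.

Lemma ldgP_prod (m n k : nagata_product) :
  k <= m \_g n <-> m * k <= gm n.
Proof.
case: m n k => [a x] [b y] [c z].
rewrite /= ldrP ldlP ldrP ract_join ractA !join_lub -(cyclic a) lractA.
by rewrite -lractA; tauto.
Qed.

Lemma rdgP_prod (m n k : nagata_product) :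
  k <= n /_g m <-> k * m <= gm n.
Proof.
case: m n k => [a x] [b y] [c z].
rewrite /= rdlP rdrP ldrP lact_join join_lub join_lub -cyclic lactA.
tauto.
Qed.

Lemma nagata_product_core : nagata_core nagata_product.
Proof.
split.
- apply: pre_conucleusI; [split |].
  + by [].
  + by move=> [a x] [b y] [/= ab _]; split=> //; apply: lact_l.
  + move=> [a ?] [b ?]; exists (a * b, 0) => /=.
    rewrite /e_scal; f_equal => /=; rewrite lractA -(cyclic b) lactA.
    by rewrite join_absorb //; apply: po_refl.
- apply: closure_operator_overI; [split |].
  + by [].
  + by move=> [a x] [b y] [/= _ xy]; split=> //; apply: ldr_iso.
  + move=> [a ?] [? x]; rewrite /e_scal /e_modl /=.
    split; split=> /=; try exact: po_refl; apply/ldrP; rewrite ractA.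
      rewrite -(cyclic a) lractA; apply: po_trans (join_r _ _).
      by apply: lact_r; apply: ldr_le.
    by apply: po_trans (join_l _ _); apply: ract_l; apply: ldr_le.
- apply: structural_overI => -[a ?] [b x]; rewrite /e_scal /e_modl /=.
  split; split=> /=.
  + apply/ldrP; rewrite ractA -(cyclic a) lractA.
    by apply: po_trans (join_r _ _); apply: lact_r; apply: ldr_le.
  + apply/join_lub; split; last exact: join_r.
    rewrite lractA; apply: po_trans (join_r _ _); apply: lact_r.
    exact: ldr_le.
  + apply/ldrP; rewrite ractA; apply: po_trans (join_l _ _).
    by apply: ract_l; apply: ldr_le.
  + apply/join_lub; split; first exact: join_l.
    rewrite -lactA cyclic ractA; apply: po_trans (join_l _ _).
    by apply: ract_l; apply: ldr_le.
- by exists (e_modl 0).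
- exact: ldgP_prod.
- exact: rdgP_prod.
- by move=> m n; exists (e_modl (m.2 \/_ n.2)).
- move=> [a x] [b y] [_z [[? z] Ez]] /=; subst _z; split=> /=.
    move=> [_ /join_lub [? ?]].
    by do ! split=> //; apply: ldr_iso.
  move=> [[_ ?] [_ ?]]; have H : x \/_ y <= z by apply/join_lub.
  by split=> //; apply: ldr_iso.
- move=> [a x] [b y]; rewrite /= /e_scal; f_equal => /=.
  rewrite lractA -(cyclic b) lactA.
  by rewrite join_absorb //; apply: po_refl.
- move=> [a x] [b y] /=; congr e_modl => /=.
  have -> : (x <* b) \/_ ((0 \_r x) *> (b *> 0)) = x <* b.
    apply: join_absorb; rewrite -lactA cyclic ractA.
    by apply: ract_l; apply: ldr_le.
  f_equal; apply: po_ext_up => z; rewrite join_lub.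
  split=> [H|[] //]; split=> //; apply: po_trans H.
  by rewrite lractA; apply: lact_r; apply: ldr_le.
- move=> [a x] [b y]; rewrite /= /e_modl /=; congr (_, _); apply: po_ext => c.
  rewrite !ldrP ldlP ract_join join_lub -lractA.
  tauto.
- move=> [a x] [b y]; rewrite /= /e_modl /=; congr (_, _); apply: po_ext => c.
  rewrite ldrP rdrP rdlP lact_join join_lub -(cyclic c) lractA (cyclic a).
  tauto.
- have H : (0 \/_ ((0 \_r 0) *> 0)) = 0 by apply/join_absorb/e_modl_l.
  by move=> [a x] /=; rewrite !H -e_modl_sym.
- move=> [a x] /=; split; congr e_modl.
    rewrite -cyclic join_absorb //.
    by rewrite -lactA cyclic ractA cyclic; apply: ract_l; apply: ldr_le.
  by rewrite join_absorb_l // lractA; apply: lact_r; apply: ldr_le.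
- by move=> [a x] [b y] [/= ab _] [_ xy].
Qed.

Lemma nagata_product_weak : weak_nagata nagata_product.
Proof.
have H x a : ((x \/_ (a *> 0)) \/_ ((0 \_r (x \/_ (a *> 0))) *> 0))
             = x \/_ (a *> 0) by apply: join_absorb; apply: e_modl_l.
split; first exact: nagata_product_core.
- by move=> [a x] [b y] /=; rewrite H.
- by move=> [a x] [b y] /=; rewrite H.
Qed.

End Product.

Arguments e_scal {B} a.
Arguments e_modl {B} x.

Definition nagata_product_map (B B' : bimodule) (f : bimodule_hom B B') :
  nagata_hom (nagata_product B) (nagata_product B').
Proof.
refine (@NagataHom (nagata_product B) (nagata_product B')
  (fun m : scal B * modl B => (hscal f m.1, hmodl f m.2)) _ _ _ _ _ _ _ _).
- move=> [a x] [b y] [/= ab xy]; split=> /=; first exact: hscal_isotone.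
  have := join_l (hmodl f x) (hmodl f y).
  by rewrite -hmodl_join join_absorb_l.
- by move=> [a x] [b y]; rewrite /= hscal_mul hmodl_join h_ract h_lact.
- by move=> [a x]; rewrite /= /e_scal h_lact h_bpt.
- by move=> [a x]; rewrite /= /e_modl h_ldr h_bpt.
- by rewrite /= h_ldr h_bpt.
- move=> [a x] [b y].
  by rewrite /= h_ldr h_ldl hmodl_join h_lact h_bpt.
- move=> [a x] [b y].
  by rewrite /= h_rdl h_rdr hmodl_join h_lact h_bpt.
- by move=> [a x] [b y]; rewrite /= /e_modl /= h_ldr hmodl_join h_bpt.
Defined.

Definition Nagata_product : functor Bimod NPosw.
Proof.
refine (@Functor Bimod NPosw
  (fun B => exist _ (nagata_product B) (@nagata_product_weak B))
  nagata_product_map _ _).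
- by move=> B; apply: nagata_hom_ext => -[].
- by move=> A B C g f; apply: nagata_hom_ext.
Defined.

Section Subalgebra.

Variables (N : nagata_algebra) (Q : N -> Prop).
Hypothesis Qmul : forall m n, Q m -> Q n -> Q (m * n).
Hypothesis Qsg : forall m, Q m -> Q (sg m).
Hypothesis Qgm : forall m, Q m -> Q (gm m).
Hypothesis Qnpt : Q npt.
Hypothesis Qldg : forall m n, Q m -> Q n -> Q (m \_g n).
Hypothesis Qrdg : forall m n, Q m -> Q n -> Q (n /_g m).
Hypothesis Qsqcup : forall m n, Q m -> Q n -> Q (m \_/ n).

Definition sub_nagata : nagata_algebra :=
  @NagataAlgebra (sub_posemigroup Qmul)
    (fun m => exist _ (sg (proj1_sig m)) (Qsg (proj2_sig m)))
    (fun m => exist _ (gm (proj1_sig m)) (Qgm (proj2_sig m)))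
    (exist _ npt Qnpt)
    (fun m n => exist _ (proj1_sig m \_g proj1_sig n)
                  (Qldg (proj2_sig m) (proj2_sig n)))
    (fun n m => exist _ (proj1_sig n /_g proj1_sig m)
                  (Qrdg (proj2_sig m) (proj2_sig n)))
    (fun m n => exist _ (proj1_sig m \_/ proj1_sig n)
                  (Qsqcup (proj2_sig m) (proj2_sig n))).

Lemma sub_nagata_core : nagata_core N -> nagata_core sub_nagata.
Proof.
move=> HN; split.
- apply: pre_conucleusI; [split |].
  + by move=> m; apply: sub_eq; apply: (core_sgK HN).
  + by move=> m n; apply: (core_sg_iso HN).
  + move=> a b; exists (sg a * sg b); apply: sub_eq => /=.
    by rewrite (sg_mul HN) !(core_sgK HN).
- apply: closure_operator_overI; [split |].
  + by move=> m; apply: sub_eq; apply: (core_gmK HN).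
  + by move=> m n; apply: (core_gm_iso HN).
  + by move=> a x; apply: (core_clos HN); [apply: (core_sgK HN) | apply: (core_gmK HN)].
- by apply: structural_overI => a m; apply: (core_str HN); apply: (core_sgK HN).
- by exists npt; apply: sub_eq; apply: (core_gm_npt HN).
- by move=> m n k; apply: (ldgP HN).
- by move=> m n k; apply: (rdgP HN).
- by move=> m n; exists (m \_/ n); apply: sub_eq; apply: (core_gm_sqcup HN).
- move=> m n [_z [z Ez]]; subst _z; apply: (core_sqcupP HN).
  exact: (core_gmK HN).
- by move=> x y; apply: sub_eq; apply: (sg_mul HN).
- by move=> x y; apply: sub_eq; apply: (gm_mul HN).
- by move=> x y; apply: sub_eq; apply: (gm_ldg HN).
- by move=> x y; apply: sub_eq; apply: (gm_rdg HN).
- by move=> x; case: (sg_gm HN (proj1_sig x)) => *; split; apply: sub_eq.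
- by move=> x; case: (gm_sg HN (proj1_sig x)) => *; split; apply: sub_eq.
- by move=> x y; apply: (nagata_quasi HN).
Qed.

End Subalgebra.

Definition in_restricted (B : bimodule) (m : nagata_product B) : Prop :=
  bpt B <* m.1 <= m.2 /\ m.1 *> bpt B <= m.2.

Section RestrictedProduct.

Variable B : bimodule.
Local Notation "0" := (bpt B) : nagata_scope.
Local Notation Q := (@in_restricted B).

Lemma in_restrictedE (m : nagata_product B) : Q m <-> m.1 *> 0 <= m.2.
Proof. by rewrite /in_restricted -cyclic; tauto. Qed.

Lemma restricted_mul (m n : nagata_product B) : Q m -> Q n -> Q (m * n).
Proof.
case: m n => [a x] [b y]; rewrite !in_restrictedE /= => _ H.
apply: po_trans (join_r _ _); rewrite lactA; exact: lact_r.
Qed.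

Lemma restricted_sg (m : nagata_product B) : Q m -> Q (sg m).
Proof. by move=> _; rewrite in_restrictedE; apply: po_refl. Qed.

Lemma restricted_e_modl (x : modl B) : Q (e_modl x).
Proof. by rewrite in_restrictedE; apply: e_modl_l. Qed.

Lemma restricted_ldg (m n : nagata_product B) : Q m -> Q n -> Q (m \_g n).
Proof.
case: m n => [a x] [b y]; rewrite !in_restrictedE /= => H _.
rewrite join_absorb // cyclic; apply/ldlP; rewrite -lractA.
apply: po_trans (ldr_le x y); exact: ract_l.
Qed.

Lemma restricted_rdg (m n : nagata_product B) : Q m -> Q n -> Q (n /_g m).
Proof.
case: m n => [a x] [b y]; rewrite !in_restrictedE /= => H _.
rewrite join_absorb //; apply/rdrP; rewrite lractA -cyclic.
by apply: (po_trans (y := (y /_l x) *> x)); [apply: lact_r | apply/rdlP; apply: po_refl].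
Qed.

Definition restricted_product : nagata_algebra :=
  @sub_nagata (nagata_product B) Q restricted_mul restricted_sg
    (fun m _ => restricted_e_modl m.2) (restricted_e_modl 0)
    restricted_ldg restricted_rdg
    (fun m n _ _ => restricted_e_modl (m.2 \/_ n.2)).

Lemma restricted_product_nagata : restricted_nagata restricted_product.
Proof.
split; [split |  |].
- by apply: sub_nagata_core; apply: nagata_product_core.
- move=> [[a x] [Hx' Hx]] [[b y] Hy]; apply: sub_eq => /=.
  by rewrite !join_absorb //; apply: e_modl_l.
- move=> [[a x] [Hx' Hx]] [[b y] Hy]; apply: sub_eq => /=.
  by rewrite !join_absorb //; apply: e_modl_l.
- by move=> [[a x] [Hx' Hx]]; split=> //=; apply: po_refl.
- by move=> [[a x] [Hx Hx']]; split=> /=; [apply/ldrP | apply: po_refl].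
Qed.

End RestrictedProduct.

Lemma restricted_map_in (B B' : bimodule) (f : bimodule_hom B B')
  (m : nagata_product B) : in_restricted m ->
  in_restricted (nagata_product_map f m).
Proof.
have Hf x y : x <= y -> hmodl f x <= hmodl f y.
  move=> xy; have := join_l (hmodl f x) (hmodl f y).
  by rewrite -hmodl_join join_absorb_l.
by case=> H1 H2; split; rewrite /= -(h_bpt f) -?h_ract -?h_lact; apply: Hf.
Qed.

Definition restricted_product_map (B B' : bimodule) (f : bimodule_hom B B') :
  nagata_hom (restricted_product B) (restricted_product B').
Proof.
refine (@NagataHom (restricted_product B) (restricted_product B')
  (fun m => exist _ (nagata_product_map f (proj1_sig m))
                  (restricted_map_in f (proj2_sig m))) _ _ _ _ _ _ _ _).
- by move=> m n; apply: (nhom_isotone (nagata_product_map f)).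
- by move=> m n; apply: sub_eq; apply: (nhom_mul (nagata_product_map f)).
- by move=> m; apply: sub_eq; apply: (nhom_sg (nagata_product_map f)).
- by move=> m; apply: sub_eq; apply: (nhom_gm (nagata_product_map f)).
- by apply: sub_eq; apply: (nhom_npt (nagata_product_map f)).
- by move=> m n; apply: sub_eq; apply: (nhom_ldg (nagata_product_map f)).
- by move=> m n; apply: sub_eq; apply: (nhom_rdg (nagata_product_map f)).
- by move=> m n; apply: sub_eq; apply: (nhom_sqcup (nagata_product_map f)).
Defined.

Definition Restricted_product : functor Bimod NPosr.
Proof.
refine (@Functor Bimod NPosr
  (fun B => exist _ (restricted_product B) (restricted_product_nagata B))
  restricted_product_map _ _).
- by move=> B; apply: nagata_hom_ext => -[[a x] H]; apply: sub_eq.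
- by move=> A B C g f; apply: nagata_hom_ext => m; apply: sub_eq.
Defined.

Definition bool_poset : poset.
Proof.
exists bool (fun a b => implb a b = true).
by split; repeat intros [|].
Defined.

Definition bool_ps : posemigroup.
Proof. by exists bool_poset andb; repeat intros [|]. Defined.

Definition bool_js : join_semilattice.
Proof. by exists bool_poset orb; do 3 (intros [|]); split=> [|[]]. Defined.

Definition bool_bimodule : bimodule.
Proof.
by exists bool_ps bool_js andb andb implb (fun y x => implb x y) implb
  (fun y a => implb a y) true; repeat intros [|].
Defined.

(* S = M = the two-element Boolean algebra, with 0 interpreted by its top. *)
Lemma nagata_product_not_nagata :
  exists B : bimodule, ~ nagata (nagata_product B).
Proof.
exists bool_bimodule => H.
by have := sg_ldg H (true, false) (false, false).
Qed.

(* Main.v *)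
(* Both units are m |-> (sg m, gm m): the Nagata identities say precisely that
   this map is a homomorphism, and the quasi-inequality that it reflects the
   order.  In the product, elements of the image of sg are determined by their
   first components and elements of the image of gm by their second components,
   so the counit is the pair of projections, with inverse (e_scal, e_modl).
   A restricted Nagata posemigroup satisfies gm (sg m) <= gm m, hence the unit
   lands in the restricted product. *)
From Stdlib Require Import ssreflect ssrfun.
Require Import Defs.
Open Scope nagata_scope.

Set Implicit Arguments.
Unset Strict Implicit.
Unset Printing Implicit Defensive.

(** * Residuals, joins and [gm (sg _)] under the core axioms *)

Section CoreFacts.

Variables (N : nagata_algebra) (HN : nagata_core N).
Implicit Types m n x y : N.

Lemma core_ldg_gm m n : m \_g gm n = m \_g n.
Proof. by apply: po_ext => k; rewrite !(ldgP HN) (core_gmK HN). Qed.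

Lemma core_rdg_gm m n : gm n /_g m = n /_g m.
Proof. by apply: po_ext => k; rewrite !(rdgP HN) (core_gmK HN). Qed.

Lemma core_sqcup_gm m n : gm m \_/ gm n = m \_/ n.
Proof.
apply: po_anti; apply/(core_sqcupP HN);
  rewrite ?(core_gm_sqcup HN) ?(core_gmK HN) //; split.
- exact: core_sqcup_l HN m n.
- exact: core_sqcup_r HN m n.
- by have := core_sqcup_l HN (gm m) (gm n); rewrite (core_gmK HN).
- by have := core_sqcup_r HN (gm m) (gm n); rewrite (core_gmK HN).
Qed.

(** The axioms on the point turn the left side into [gm (npt * sg (npt \_g gm y))], and [npt] times
    the scalar part of its own residual stays below [gm y]. *)
Lemma core_gm_sg_gm_le y : gm (sg (gm y)) <= gm y.
Proof.
have [E _] := sg_gm HN y; have [-> _] := gm_sg HN (gm y).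
apply: (core_gm_le HN); first exact: core_gmK HN y.
rewrite E -{1}(core_gm_npt HN).
by apply: (core_ldr_bound HN); apply: core_gmK HN y.
Qed.

Lemma core_gm_sg_le m y : m <= gm y -> gm (sg m) <= gm y.
Proof.
move=> H; apply: po_trans (core_gm_sg_gm_le y).
by apply: (core_gm_iso HN); apply: (core_sg_iso HN).
Qed.

(** With [k = x \_g gm y], structurality bounds the product by [gm (sg x * sg k) = gm (sg (x * k))],
    and [x * k <= gm y]. *)
Lemma core_gm_sg_ldg_le x y : gm (sg x) * sg (x \_g gm y) <= gm y.
Proof.
have [_ H] := core_str HN (sg x) (core_sgK HN (x \_g gm y)).
apply: po_trans H _; rewrite -(sg_mul HN); apply: core_gm_sg_le.
by apply/(core_ldgP HN); [apply: core_gmK HN y | apply: po_refl].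
Qed.

Lemma core_gm_sg_rdg_le x y : sg (gm y /_g x) * gm (sg x) <= gm y.
Proof.
have [H _] := core_str HN (sg x) (core_sgK HN (gm y /_g x)).
apply: po_trans H _; rewrite -(sg_mul HN); apply: core_gm_sg_le.
by apply/(core_rdgP HN); [apply: core_gmK HN y | apply: po_refl].
Qed.

(* Distributivity of an action over joins, in residuated form. *)
Lemma core_sqcup_mul_le m n a y : sg a = a ->
  gm m * a <= gm y -> gm n * a <= gm y -> (m \_/ n) * a <= gm y.
Proof.
move=> Ea Hm Hn.
have Ey := core_gmK HN y.
apply/(core_rdrP HN Ea (core_gm_sqcup HN m n) Ey).
apply/(core_sqcupP HN); first exact: core_gmK HN _.
by split; apply/(core_rdrP HN Ea (core_gmK HN _) Ey).
Qed.

Lemma core_mul_sqcup_le m n a y : sg a = a ->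
  a * gm m <= gm y -> a * gm n <= gm y -> a * (m \_/ n) <= gm y.
Proof.
move=> Ea Hm Hn.
have Ey := core_gmK HN y.
apply/(core_ldlP HN Ea (core_gm_sqcup HN m n) Ey).
apply/(core_sqcupP HN); first exact: core_gmK HN _.
by split; apply/(core_ldlP HN Ea (core_gmK HN _) Ey).
Qed.

End CoreFacts.

(** After [sg_ldg] the divisors compared are [gm x] and the larger [x \_/ sg x], so one inequality
    is antitonicity. For the other, [sg (x \_g gm y)] multiplies both [gm x] and [gm (sg x)] below
    [gm y], hence also their join. *)
Lemma nagata_weak (N : nagata_algebra) : nagata N -> weak_nagata N.
Proof.
move=> HN; have HC : nagata_core N := HN; split=> // x y.
all: have Ey := core_gmK HC y; have Es := core_gm_sqcup HC x (sg x).
- rewrite (sg_ldg HN); apply: po_anti.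
  + apply/(core_ldrP HC (core_sgK HC _) Es Ey).
    apply: (core_sqcup_mul_le HC); first exact: core_sgK HC _.
      by apply/(core_ldrP HC (core_sgK HC _) (core_gmK HC _) Ey); apply: po_refl.
    by rewrite -(sg_ldg HN); apply: core_gm_sg_ldg_le.
  + apply: (core_sg_iso HC); apply/(core_ldgP HC) => //.
    apply: po_trans; first by apply: mul_l; apply: core_sqcup_l HC x (sg x).
    by apply/(core_ldgP HC) => //; apply: po_refl.
- rewrite (sg_rdg HN); apply: po_anti.
  + apply/(core_rdlP HC (core_sgK HC _) Es Ey).
    apply: (core_mul_sqcup_le HC); first exact: core_sgK HC _.
      by apply/(core_rdlP HC (core_sgK HC _) (core_gmK HC _) Ey); apply: po_refl.
    by rewrite -(sg_rdg HN); apply: core_gm_sg_rdg_le.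
  + apply: (core_sg_iso HC); apply/(core_rdgP HC) => //.
    apply: po_trans; first by apply: mul_r; apply: core_sqcup_l HC x (sg x).
    by apply/(core_rdgP HC) => //; apply: po_refl.
Qed.

(** * The unit into the Nagata product *)

Lemma nagata_unit_reflects (N : nagata_algebra) (HN : nagata_core N) (m n : N) :
  sg m <= sg n /\ gm m <= gm n <-> m <= n.
Proof.
split; first by case; apply: (nagata_quasi HN).
by split; [apply: (core_sg_iso HN) | apply: (core_gm_iso HN)].
Qed.

(* [HN] follows from [HW]; it is a separate argument because the structural
   bimodules of the two functors carry different proofs of it. *)
Definition nagata_unit (N : nagata_algebra) (HN : nagata_core N)
  (HW : weak_nagata N) :
  nagata_hom N (nagata_product (structural_bimodule HN)).
Proof.
refine (@NagataHom N (nagata_product (structural_bimodule HN))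
  (fun m => (to_img sg m, to_img gm m)) _ _ _ _ _ _ _ _).
- by move=> m n /(nagata_unit_reflects HN).
- move=> m n; congr pair; apply: sub_eq; first exact: sg_mul HN m n.
  exact: gm_mul HN m n.
- move=> m; congr pair; apply: sub_eq; first exact: core_sgK HN m.
  by case: (gm_sg HN m).
- move=> m; congr pair; apply: sub_eq; last exact: core_gmK HN m.
  by case: (sg_gm HN m).
- congr pair; apply: sub_eq; last exact: core_gm_npt HN.
  by have [E _] := sg_gm HN npt; move: E; rewrite (core_gm_npt HN).
- move=> m n; congr pair; apply: sub_eq => /=.
  (* The divisor [m.2 \/_ (m.1 *> 0)] of the product is here [gm m \_/ gm (sg m * npt)], which
     equals [m \_/ sg m]: exactly the divisor of the weak law. *)
  + have [_ <-] := gm_sg HN m.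
    by rewrite (core_sqcup_gm HN) -(sg_ldg_weak HW) (core_ldg_gm HN).
  + rewrite -(core_ldg_gm HN m n) (gm_ldg HN).
    by rewrite (gm_ldg HN (sg m)) (core_sgK HN).
- move=> m n; congr pair; apply: sub_eq => /=.
  + have [_ <-] := gm_sg HN m.
    by rewrite (core_sqcup_gm HN) -(sg_rdg_weak HW) (core_rdg_gm HN).
  + rewrite -(core_rdg_gm HN m n) (gm_rdg HN).
    by rewrite (gm_rdg HN (sg m)) (core_sgK HN).
- move=> m n; congr pair; apply: sub_eq; rewrite /= (core_sqcup_gm HN).
    by have [E _] := sg_gm HN (m \_/ n); move: E; rewrite (core_gm_sqcup HN).
  exact: core_gm_sqcup HN m n.
Defined.

(** * The counit and its inverse *)

Section Counit.

Variable B : bimodule.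
Local Notation P := (nagata_product B).

Lemma img_sgE (a : img (@sg P)) : proj1_sig a = e_scal (proj1_sig a).1.
Proof. by case: a => _ [m /= <-]. Qed.

Lemma img_gmE (x : img (@gm P)) : proj1_sig x = e_modl (proj1_sig x).2.
Proof. by case: x => _ [m /= <-]. Qed.

Definition nagata_counit (HP : nagata_core P) :
  bimodule_hom (structural_bimodule HP) B.
Proof.
refine (@BimoduleHom (structural_bimodule HP) B
  (fun a : img (@sg P) => (proj1_sig a).1)
  (fun x : img (@gm P) => (proj1_sig x).2) _ _ _ _ _ _ _ _ _ _) => //.
- by move=> a b [].
- move=> a x; rewrite /= (img_sgE a) (img_gmE x) /=.
  (* The extra summand [(a *> 0) <* (0 \_r x)] is [a *> (0 <* (0 \_r x))], hence below [a *> x]. *)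
  by apply: join_absorb_l; rewrite lractA; apply: lact_r; apply: ldr_le.
- move=> a x; rewrite /= (img_sgE a) (img_gmE x) /=.
  apply: join_absorb; rewrite -lactA cyclic ractA.
  by apply: ract_l; apply: ldr_le.
(* On the image of [gm] the divisor [x \/_ ((0 \_r x) *> 0)] collapses to [x]. *)
- move=> x y; rewrite /= (img_gmE x) /=.
  by rewrite join_absorb //; apply: e_modl_l.
- move=> x y; rewrite /= (img_gmE x) /=.
  by rewrite join_absorb //; apply: e_modl_l.
Defined.

Definition restricted_incl : nagata_hom (restricted_product B) P.
Proof. by exists (fun m => proj1_sig m). Defined.

(** Composing with the inclusion into the full product reuses the bimodule laws already checked for
    [nagata_counit]. *)
Definition restricted_counit (HP : nagata_core P)
  (HR : nagata_core (restricted_product B)) :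
  bimodule_hom (structural_bimodule HR) B :=
  bimodule_comp (nagata_counit HP) (structural_map HR HP restricted_incl).

End Counit.

(** Operations transfer along a bijection, but the order on scalars does not, so [gs_isotone] is
    assumed. On modules the order is determined by joins. *)
Definition bimodule_hom_inverse (A B : bimodule) (f : bimodule_hom A B)
  (gs : scal B -> scal A) (gm : modl B -> modl A)
  (gs_isotone : forall a b, a <= b -> gs a <= gs b)
  (fsK : cancel (hscal f) gs) (gsK : cancel gs (hscal f))
  (fmK : cancel (hmodl f) gm) (gmK : cancel gm (hmodl f)) :
  bimodule_hom B A.
Proof.
exists gs gm => //.
- by move=> a b; rewrite -{1}(gsK a) -{1}(gsK b) -hscal_mul fsK.
- by move=> x y; rewrite -{1}(gmK x) -{1}(gmK y) -hmodl_join fmK.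
- by move=> a x; rewrite -{1}(gsK a) -{1}(gmK x) -h_lact fmK.
- by move=> a x; rewrite -{1}(gsK a) -{1}(gmK x) -h_ract fmK.
- by move=> a y; rewrite -{1}(gsK a) -{1}(gmK y) -h_ldl fmK.
- by move=> x y; rewrite -{1}(gmK x) -{1}(gmK y) -h_rdl fsK.
- by move=> x y; rewrite -{1}(gmK x) -{1}(gmK y) -h_ldr fsK.
- by move=> a y; rewrite -{1}(gsK a) -{1}(gmK y) -h_rdr fmK.
- by rewrite -(h_bpt f) fmK.
Defined.

Lemma e_scal_isotone (B : bimodule) (a b : scal B) : a <= b ->
  po_le (p := nagata_product B) (e_scal a) (e_scal b).
Proof. by move=> ab; split=> //; apply: lact_l. Qed.

Definition nagata_counit_inv (B : bimodule)
  (HP : nagata_core (nagata_product B)) :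
  bimodule_hom B (structural_bimodule HP).
Proof.
refine (@bimodule_hom_inverse _ _ (nagata_counit HP)
  (fun a => to_img (@sg (nagata_product B)) (e_scal a))
  (fun x => to_img (@gm (nagata_product B)) (e_modl x)) _ _ _ _ _) => //.
- by move=> a b; apply: e_scal_isotone.
- by move=> a; apply: sub_eq; rewrite [RHS]img_sgE.
- by move=> x; apply: sub_eq; rewrite [RHS]img_gmE.
Defined.

Lemma restricted_e_scal (B : bimodule) (a : scal B) : in_restricted (e_scal a).
Proof. by apply/in_restrictedE; apply: po_refl. Qed.

Definition restricted_counit_inv (B : bimodule)
  (HP : nagata_core (nagata_product B))
  (HR : nagata_core (restricted_product B)) :
  bimodule_hom B (structural_bimodule HR).
Proof.
refine (@bimodule_hom_inverse _ _ (restricted_counit HP HR)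
  (fun a => to_img (@sg (restricted_product B))
    (exist _ (e_scal a) (restricted_e_scal a)))
  (fun x => to_img (@gm (restricted_product B))
    (exist _ (e_modl x) (restricted_e_modl x))) _ _ _ _ _) => //.
- by move=> a b; apply: e_scal_isotone.
- by move=> [y [m E]]; subst y; do 2 apply: sub_eq.
- by move=> [y [m E]]; subst y; do 2 apply: sub_eq.
Defined.

(** * The unit in the restricted case *)

Lemma nagata_unit_restricted (N : nagata_algebra) (HN : nagata_core N)
  (HW : weak_nagata N) : (forall m : N, sg m <= m) ->
  forall m : N, in_restricted (nagata_unit HN HW m).
Proof.
move=> sg_le m; apply/in_restrictedE => /=.
(* The action of [sg m] on the point, [gm (sg m * npt)], is [gm (sg m)]. *)
have [_ <-] := gm_sg HN m.
exact: (core_gm_iso HN).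
Qed.

Definition restricted_unit (N : nagata_algebra) (HN : nagata_core N)
  (HR : restricted_nagata N) :
  nagata_hom N (restricted_product (structural_bimodule HN)).
Proof.
pose u := nagata_unit HN (nagata_weak HR).
refine (@NagataHom N (restricted_product (structural_bimodule HN))
  (fun m => exist _ (u m)
    (nagata_unit_restricted HN (nagata_weak HR) (sg_interior HR) m))
  _ _ _ _ _ _ _ _).
- exact: (nhom_isotone u).
- by move=> m n; apply: sub_eq; apply: (nhom_mul u).
- by move=> m; apply: sub_eq; apply: (nhom_sg u).
- by move=> m; apply: sub_eq; apply: (nhom_gm u).
- by apply: sub_eq; apply: (nhom_npt u).
- by move=> m n; apply: sub_eq; apply: (nhom_ldg u).
- by move=> m n; apply: sub_eq; apply: (nhom_rdg u).
- by move=> m n; apply: sub_eq; apply: (nhom_sqcup u).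
Defined.

(** * Naturality and triangle identities *)

Definition nagata_adjunction : adjunction structuralw Nagata_product.
Proof.
refine (@Adjunction NPosw Bimod structuralw Nagata_product
  (fun N => nagata_unit (proj2_sig N : nagata_core _) (proj2_sig N))
  (fun B => nagata_counit (nagata_product_weak B)) _ _ _ _).
- move=> N N' f; apply: nagata_hom_ext => m.
  by congr pair; apply: sub_eq; [apply: nhom_sg | apply: nhom_gm].
- by move=> B B' g; apply: bimodule_hom_ext.
(* The composite acts as [sg] on scalars and as [gm] on the module, and each fixes its own image. *)
- move=> N; apply: bimodule_hom_ext => a; apply: sub_eq.
    exact: sgE (proj2_sig N : nagata_core _) a.
  exact: gmE (proj2_sig N : nagata_core _) a.
- by move=> B; apply: nagata_hom_ext => -[].
Defined.

Definition restricted_adjunction : adjunction structuralr Restricted_product.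
Proof.
refine (@Adjunction NPosr Bimod structuralr Restricted_product
  (fun N => restricted_unit (proj2_sig N : nagata_core _) (proj2_sig N))
  (fun B => restricted_counit (nagata_product_core B)
    (restricted_product_nagata B)) _ _ _ _).
- move=> N N' f; apply: nagata_hom_ext => m; apply: sub_eq.
  by congr pair; apply: sub_eq; [apply: nhom_sg | apply: nhom_gm].
- by move=> B B' g; apply: bimodule_hom_ext.
- move=> N; apply: bimodule_hom_ext => a; apply: sub_eq.
    exact: sgE (proj2_sig N : nagata_core _) a.
  exact: gmE (proj2_sig N : nagata_core _) a.
- by move=> B; apply: nagata_hom_ext => -[[a x] H]; apply: sub_eq.
Defined.

(** The middle clause places every Nagata posemigroup in [NPosw], the category over which the
    unrestricted adjunction is stated. The two composites with [e] identify the counit as its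
    inverse. *)
Theorem theoremA :
  (* restricted Nagata posemigroups *)
  (exists A : adjunction structuralr Restricted_product,
    (forall (N : NPosr) (m n : (proj1_sig N : nagata_algebra)),
      let eta : nagata_hom (proj1_sig N) (restricted_product (structuralr N)) :=
        adj_unit A N in
      proj1_sig (eta m) = (to_img sg m, to_img gm m) /\
      (eta m <= eta n <-> m <= n)) /\
    (forall B : Bimod,
      exists e : Hom B (structuralr (Restricted_product B)),
        (forall a : scal B, proj1_sig (proj1_sig (hscal e a)) = e_scal a) /\
        (forall x : modl B, proj1_sig (proj1_sig (hmodl e x)) = e_modl x) /\
        mcomp (adj_counit A B) e = idm B /\
        mcomp e (adj_counit A B) = idm (structuralr (Restricted_product B)))) /\
  (* Nagata posemigroups; NPosw is the full subcategory [weak_nagata] *)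
  (forall N : nagata_algebra, nagata N -> weak_nagata N) /\
  (exists A : adjunction structuralw Nagata_product,
    (forall (N : NPosw) (m n : (proj1_sig N : nagata_algebra)),
      let eta : nagata_hom (proj1_sig N) (nagata_product (structuralw N)) :=
        adj_unit A N in
      eta m = (to_img sg m, to_img gm m) /\
      (eta m <= eta n <-> m <= n)) /\
    (forall B : Bimod,
      exists e : Hom B (structuralw (Nagata_product B)),
        (forall a : scal B, proj1_sig (hscal e a) = e_scal a) /\
        (forall x : modl B, proj1_sig (hmodl e x) = e_modl x) /\
        mcomp (adj_counit A B) e = idm B /\
        mcomp e (adj_counit A B) = idm (structuralw (Nagata_product B)))).
Proof.
split; last split.
- exists restricted_adjunction; split.
    move=> N m n /=; split=> //.
    exact: nagata_unit_reflects (proj2_sig N : nagata_core _) m n.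
  move=> B.
  exists (restricted_counit_inv (nagata_product_core B)
    (restricted_product_nagata B)); do 2 split=> //.
  split; apply: bimodule_hom_ext => //.
  + by move=> [y [m E]]; subst y; do 2 apply: sub_eq.
  + by move=> [y [m E]]; subst y; do 2 apply: sub_eq.
- exact: nagata_weak.
- exists nagata_adjunction; split.
    move=> N m n /=; split=> //.
    exact: nagata_unit_reflects (proj2_sig N : nagata_core _) m n.
  move=> B; exists (nagata_counit_inv (nagata_product_weak B)); do 2 split=> //.
  split; apply: bimodule_hom_ext => //.
  + by move=> [y [m E]]; subst y; apply: sub_eq.
  + by move=> [y [m E]]; subst y; apply: sub_eq.
Qed.
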